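(* Let $A$ be an associative Banach $D$-algebra with unit $1$, and let $C\in A$. If $a,b\in A$ satisfy $ab=C$, then the map $y=ae^xb$, $x\in A$, is a solution of the differential equation $$\frac{dy}{dx}\circ 1=y$$ with initial condition $y=C$ at $x=0$.
   Context: $D$ is a complete commutative (normed) ring of characteristic $0$; real scalars act on $D$-modules (derivatives are computed with real increments $t\to0$). The exponent is $e^x=\sum_{n=0}^\infty\frac1{n!}x^n$. For $y:A\to A$ the derivative $\frac{dy}{dx}$ at $x$ is the $D$-linear map $A\to A$ with $y(x+h)-y(x)=\frac{dy}{dx}\circ h+o(h)$, and $\frac{dy}{dx}\circ 1$ is its value at the unit. *)

(* Defs.v *)
From HB Require Import structures.
From mathcomp Require Import all_boot all_order all_algebra.
From mathcomp Require Import all_classical all_reals all_analysis.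

Set Implicit Arguments.
Unset Strict Implicit.
Unset Printing Implicit Defensive.

Import Order.TTheory GRing.Theory Num.Theory numFieldNormedType.Exports.

Local Open Scope classical_set_scope.
Local Open Scope ring_scope.

(* [numDomainType] is both a ring and a group normed by itself, which prevents
   Hierarchy Builder from declaring another structure joining a ring with a
   norm valued in a different type.  Both structures below hence put the ring
   operations and their laws in a mixin on a normed group, and the algebra
   instances of the library are derived from it; the same holds for the
   completeness of Banach algebras. *)

(* Real scalars act on [D]-modules through the [R]-algebra structure of [D]:
   [r : R] acts on a [D]-module as [r%:A : D]. *)
HB.mixin Record isNormedComRing (R : realType) D
    & CompleteNormedModule R D := {
  dring_one : D;
  dring_mul : D -> D -> D;
  dring_mulA : associative dring_mul;
  dring_mulC : commutative dring_mul;
  dring_mul1r : left_id dring_one dring_mul;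
  dring_mulDl : left_distributive dring_mul +%R;
  dring_oner_neq0 : dring_one != 0;
  dring_scalerAl : forall (r : R) (c d : D),
    r *: dring_mul c d = dring_mul (r *: c) d;
  dring_normM : forall c d : D, `|dring_mul c d| <= `|c| * `|d|
}.

#[short(type="completeNormedComRingType")]
HB.structure Definition CompleteNormedComRing (R : realType) :=
  {D of CompleteNormedModule R D & isNormedComRing R D}.

HB.instance Definition _ (R : realType) (D : completeNormedComRingType R) :=
  GRing.Zmodule_isComNzRing.Build (CompleteNormedComRing.sort D)
    (@dring_mulA R D) (@dring_mulC R D) (@dring_mul1r R D) (@dring_mulDl R D)
    (@dring_oner_neq0 R D).

HB.instance Definition _ (R : realType) (D : completeNormedComRingType R) :=
  GRing.Lmodule_isLalgebra.Build R (CompleteNormedComRing.sort D)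
    (@dring_scalerAl R D).

HB.instance Definition _ (R : realType) (D : completeNormedComRingType R) :=
  GRing.Lalgebra_isComAlgebra.Build R (CompleteNormedComRing.sort D).

(* Characteristic 0 is a consequence of the real structure. *)
Lemma complete_normed_ring_char0 (R : realType)
    (D : completeNormedComRingType R) (n : nat) :
  n.+1%:R != 0 :> D.
Proof. by rewrite -(scaler_nat _ (1 : D)) scaler_eq0 pnatr_eq0 oner_eq0. Qed.

HB.mixin Record isBanachAlgebra (R : realType)
    (D : completeNormedComRingType R) A
    & PseudoMetricNormedZmod R A := {
  balg_cauchy_cvg : forall F : set_system A,
    ProperFilter F -> cauchy F -> cvg F;
  balg_one : A;
  balg_mul : A -> A -> A;
  balg_scale : D -> A -> A;
  balg_mulA : associative balg_mul;
  balg_mul1r : left_id balg_one balg_mul;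
  balg_mulr1 : right_id balg_one balg_mul;
  balg_mulDl : left_distributive balg_mul +%R;
  balg_mulDr : right_distributive balg_mul +%R;
  balg_oner_neq0 : balg_one != 0;
  balg_scalerA : forall c d a,
    balg_scale c (balg_scale d a) = balg_scale (c * d) a;
  balg_scale1r : left_id 1 balg_scale;
  balg_scalerDr : right_distributive balg_scale +%R;
  balg_scalerDl : forall a, {morph balg_scale^~ a : c d / c + d};
  balg_scalerAl : forall d a b,
    balg_scale d (balg_mul a b) = balg_mul (balg_scale d a) b;
  balg_scalerAr : forall d a b,
    balg_scale d (balg_mul a b) = balg_mul a (balg_scale d b);
  balg_normM : forall a b, `|balg_mul a b| <= `|a| * `|b|;
  balg_normZ : forall d a, `|balg_scale d a| <= `|d| * `|a|
}.

#[short(type="banachAlgType")]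
HB.structure Definition BanachAlgebra (R : realType)
    (D : completeNormedComRingType R) :=
  {A of PseudoMetricNormedZmod R A & isBanachAlgebra R D A}.

Section BanachAlgebraInstances.
Context (R : realType) (D : completeNormedComRingType R) (A : banachAlgType D).

HB.instance Definition _ :=
  Uniform_isComplete.Build (BanachAlgebra.sort A) (@balg_cauchy_cvg R D A).

HB.instance Definition _ :=
  GRing.Zmodule_isNzRing.Build (BanachAlgebra.sort A)
    (@balg_mulA R D A) (@balg_mul1r R D A) (@balg_mulr1 R D A)
    (@balg_mulDl R D A) (@balg_mulDr R D A) (@balg_oner_neq0 R D A).

HB.instance Definition _ :=
  GRing.Zmodule_isLmodule.Build D (BanachAlgebra.sort A)
    (@balg_scalerA R D A) (@balg_scale1r R D A) (@balg_scalerDr R D A)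
    (@balg_scalerDl R D A).

HB.instance Definition _ :=
  GRing.Lmodule_isLalgebra.Build D (BanachAlgebra.sort A)
    (@balg_scalerAl R D A).

HB.instance Definition _ :=
  GRing.Lalgebra_isAlgebra.Build D (BanachAlgebra.sort A)
    (@balg_scalerAr R D A).

End BanachAlgebraInstances.

Section BanachAlgebraCalculus.
Context {R : realType} {D : completeNormedComRingType R} {A : banachAlgType D}.

Definition exponent (x : A) : A :=
  limn (series (fun n => ((n`!%:R^-1 : R)%:A : D) *: x ^+ n)).

(* f (x + h) - f x = df h + o(h); for given [f] and [x] there is at most one
   such [D]-linear map [df], and it is continuous as soon as [f] is continuous
   at [x]. *)
Definition is_derivative (f : A -> A) (x : A) (df : {linear A -> A}) : Prop :=
  forall e : R, 0 < e ->
    \forall h \near (0 : A), `|f (x + h) - f x - df h| <= e * `|h|.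

End BanachAlgebraCalculus.

(* Main.v *)
(* The derivative of the power x^n is dpow x h n = \sum_(i + j = n - 1) x^i h x^j,
   and h |-> \sum_n dpow x h n / n! is the derivative of the exponent.  With
   L = |x| + 1 and |h| <= 1, induction on n bounds the second-order remainder
   (x + h)^n - x^n - dpow x h n by |1| |h|^2 L^n, so that after summation the
   remainder of the exponent is at most |1_D| |1| e^L |h|^2 = o(h).  At h = 1
   every summand of dpow x 1 n is x^(n - 1), and the series of the derivative
   becomes that of e^x shifted by one index. *)
From HB Require Import structures.
Require Import Defs.
From mathcomp Require Import all_boot all_order all_algebra.
From mathcomp Require Import all_classical all_reals all_analysis.
From mathcomp Require Import ring.

Set Implicit Arguments.
Unset Strict Implicit.

Import Order.TTheory GRing.Theory Num.Theory numFieldNormedType.Exports.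

Local Open Scope classical_set_scope.
Local Open Scope ring_scope.

(* [A] is not a normed module over [R], because [r%:A *: a] need not have norm
   [`|r| * `|a|] when the unit of [D] has norm greater than 1: the library's
   results on normally convergent series do not apply. *)
Section DominatedSeries.
Context {R : realType} {D : completeNormedComRingType R} {A : banachAlgType D}.
Implicit Types (u : nat -> A) (v : nat -> R).

(** By the Cauchy criterion: blocks of [series u] are bounded in norm by those of [series v], and
    [A] is complete. *)
Lemma is_cvg_series_dominated u v : (forall n, `|u n| <= v n) ->
  cvgn (series v) -> cvgn (series u).
Proof.
move=> uv /cauchy_cvgP/cauchy_ballP v_cauchy.
apply/cauchy_cvgP/cauchy_ballP => e e0.
have := v_cauchy e e0; rewrite !near_map2 -!ball_normE.
apply: filterS => -[m n] /=.
wlog mn : m n / (m <= n)%N => [wlg|].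
  have [|/ltnW] := leqP m n; first exact: wlg.
  by rewrite distrC (distrC (series u m)); exact: wlg.
rewrite distrC (distrC (series u m)) !sub_series_geq//; apply: le_lt_trans.
rewrite (le_trans (ler_norm_sum _ _ _))// (le_trans _ (ler_norm _))//.
exact: ler_sum.
Qed.

Lemma norm_lim_series_le u v : (forall n, `|u n| <= v n) ->
  cvgn (series v) -> `|limn (series u)| <= limn (series v).
Proof.
move=> uv cv; have cu := is_cvg_series_dominated uv cv.
rewrite -(cvg_lim _ (cvg_norm cu))//; apply: ler_lim => //.
  exact: cvgP (cvg_norm cu).
near=> n; rewrite (le_trans (ler_norm_sum _ _ _))//; exact: ler_sum.
Unshelve. all: by end_near. Qed.

Lemma lim_seriesZl (d : D) u : cvgn (series u) ->
  limn (series (fun n => d *: u n)) = d *: limn (series u).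
Proof.
move=> cu; apply: cvg_lim; first exact: norm_hausdorff.
have -> : series (fun n => d *: u n) = (fun n => d *: series u n).
  by apply/funext => n; rewrite /series /= scaler_sumr.
(* Scaling by [d] is [|d|]-Lipschitz; adding 1 keeps the divisor positive when [d = 0]. *)
have d1 : 0 < `|d| + 1 by rewrite ltr_wpDl.
apply/cvgrPdist_lt => e e0; have /cvgrPdist_lt := cu.
move=> /(_ (e / (`|d| + 1))); rewrite divr_gt0// => /(_ isT).
apply: filterS => n; rewrite ltr_pdivlMr// -scalerBr; apply: le_lt_trans.
rewrite (le_trans (balg_normZ _ _))// mulrC ler_wpM2l// lerDl//.
Qed.

End DominatedSeries.

Section ExponentialSum.
Context {R : realType} {D : completeNormedComRingType R} {A : banachAlgType D}.
Implicit Types (u v : nat -> A) (c M : R) (x y z w h k : A) (n : nat).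

Definition expsum u : A :=
  limn (series (fun n => ((n`!%:R^-1 : R)%:A : D) *: u n)).

(** Geometric growth lets the real exponential series at [M] dominate [expsum u], so one estimate
    serves powers, their differences and [dpow]. *)
Definition exp_bounded u c M := forall n, `|u n| <= c * M ^+ n.

(** The factor [|1 : D|] is the norm cost of letting a real act through [r%:A]. *)
Lemma exp_bounded_term u c M : exp_bounded u c M -> forall n,
  `|((n`!%:R^-1 : R)%:A : D) *: u n| <= ((`|1 : D| * c) *: exp_coeff M) n.
Proof.
move=> uM n; rewrite (le_trans (balg_normZ _ _))// normrZ ger0_norm ?invr_ge0//.
rewrite -[leRHS]/(`|1 : D| * c * (M ^+ n / n`!%:R)).
rewrite mulrA [leRHS]mulrC -!mulrA ler_wpM2l ?invr_ge0//.
by rewrite ler_wpM2l.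
Qed.

Lemma exp_boundedD u v c c' M : exp_bounded u c M -> exp_bounded v c' M ->
  exp_bounded (fun n => u n + v n) (c + c') M.
Proof.
move=> uM vM n; rewrite (le_trans (ler_normD _ _))// mulrDl.
exact: lerD (uM n) (vM n).
Qed.

Lemma exp_boundedZ (d : D) u c M : exp_bounded u c M ->
  exp_bounded (fun n => d *: u n) (`|d| * c) M.
Proof.
move=> uM n; rewrite (le_trans (balg_normZ _ _))// -mulrA.
exact: ler_wpM2l (uM n).
Qed.

Lemma is_cvg_expsum u c M : exp_bounded u c M ->
  cvgn (series (fun n => ((n`!%:R^-1 : R)%:A : D) *: u n)).
Proof.
move=> uM; apply: is_cvg_series_dominated (exp_bounded_term uM) _.
exact/is_cvg_seriesZ/is_cvg_series_exp_coeff.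
Qed.

Lemma norm_expsum_le u c M : exp_bounded u c M ->
  `|expsum u| <= `|1 : D| * c * expR M.
Proof.
move=> uM; have cM := is_cvg_series_exp_coeff M.
rewrite (le_trans (norm_lim_series_le (exp_bounded_term uM) _))//.
  exact: is_cvg_seriesZ.
by rewrite lim_seriesZ.
Qed.

Lemma expsumD u v c M c' M' : exp_bounded u c M -> exp_bounded v c' M' ->
  expsum (fun n => u n + v n) = expsum u + expsum v.
Proof.
move=> uM vM; rewrite /expsum -limD; [|exact: is_cvg_expsum uM|exact: is_cvg_expsum vM].
congr (limn _); rewrite -seriesD; congr series.
by apply/funext => n; rewrite scalerDr.
Qed.

Lemma expsumZ (d : D) u c M : exp_bounded u c M ->
  expsum (fun n => d *: u n) = d *: expsum u.
Proof.
move=> uM; rewrite /expsum -lim_seriesZl; last exact: is_cvg_expsum uM.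
congr (limn (series _)); apply/funext => n.
by rewrite !scalerA mulrC.
Qed.

(** The product rule for [x ^+ n' * x], with the order of the factors kept since [A] need not be
    commutative. *)
Fixpoint dpow x h n : A :=
  if n is n'.+1 then dpow x h n' * x + x ^+ n' * h else 0.

Lemma dpow_linear x n (d : D) h k :
  dpow x (d *: h + k) n = d *: dpow x h n + dpow x k n.
Proof.
elim: n => [|n IHn] /=; first by rewrite scaler0 addr0.
rewrite IHn mulrDl mulrDr scalerDr -!scalerAl -!scalerAr.
by rewrite !addrA -!(addrAC _ (dpow x k n * x)).
Qed.

Lemma dpow1 x n : dpow x 1 n.+1 = n.+1%:R *: x ^+ n.
Proof.
elim: n => [|n IHn]; first by rewrite /= mul0r add0r mulr1 scale1r.
rewrite -[LHS]/(dpow x 1 n.+1 * x + x ^+ n.+1 * 1) IHn mulr1 -scalerAl -exprSr.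
by rewrite -[in RHS]natr1 scalerDl scale1r.
Qed.

(** The common step of the three inductions below: the [z] term uses up the [|x|] of the factor
    [|x| + 1], and the [w] term is absorbed by its 1. *)
Lemma norm_recurrence_le x h z w c c' n : c' * `|h| <= c ->
  `|z| <= c * (`|x| + 1) ^+ n -> `|w| <= c' * (`|x| + 1) ^+ n ->
  `|z * x + w * h| <= c * (`|x| + 1) ^+ n.+1.
Proof.
move=> ch zc wc; rewrite (le_trans (ler_normD _ _))// exprS mulrDl mul1r mulrDr.
rewrite lerD//.
  by rewrite (le_trans (balg_normM _ _))// mulrCA mulrC ler_wpM2l.
rewrite (le_trans (balg_normM _ _))//.
by rewrite (le_trans (ler_wpM2r (normr_ge0 h) wc))// mulrAC ler_wpM2r//.
Qed.

(* The norm of [1 : A] may exceed 1. *)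
Lemma exp_bounded_expr x y : `|y| <= `|x| + 1 ->
  exp_bounded (fun n => y ^+ n) `|1 : A| (`|x| + 1).
Proof.
move=> yx; elim=> [|n IHn]; first by rewrite !expr0 mulr1.
rewrite exprSr (le_trans (balg_normM _ _))// [in leRHS]exprSr mulrA.
exact: ler_pM.
Qed.

Lemma exp_bounded_dpow x h :
  exp_bounded (dpow x h) (`|1 : A| * `|h|) (`|x| + 1).
Proof.
elim=> [|n IHn]; first by rewrite /= normr0 !mulr_ge0.
apply: norm_recurrence_le IHn _; first exact: lexx.
by apply: exp_bounded_expr; rewrite lerDl.
Qed.

Lemma exp_bounded_exprB x h : `|h| <= 1 ->
  exp_bounded (fun n => (x + h) ^+ n - x ^+ n) (`|1 : A| * `|h|) (`|x| + 1).
Proof.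
move=> h1; elim=> [|n IHn]; first by rewrite subrr normr0 !mulr_ge0.
have -> : (x + h) ^+ n.+1 - x ^+ n.+1 =
    ((x + h) ^+ n - x ^+ n) * x + (x + h) ^+ n * h.
  by rewrite !exprSr mulrDr mulrBl addrAC.
apply: norm_recurrence_le IHn _; first exact: lexx.
by apply: exp_bounded_expr; rewrite (le_trans (ler_normD _ _))// lerD2l.
Qed.

(** In the recurrence of the remainder, [h] is multiplied by [(x + h) ^+ n - x ^+ n], itself of
    first order in [h]; hence the second factor [|h|]. *)
Lemma exp_bounded_expr_rem x h : `|h| <= 1 ->
  exp_bounded (fun n => (x + h) ^+ n - x ^+ n - dpow x h n)
    (`|1 : A| * `|h| * `|h|) (`|x| + 1).
Proof.
move=> h1; elim=> [|n IHn]; first by rewrite /= subrr subr0 normr0 !mulr_ge0.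
have -> : (x + h) ^+ n.+1 - x ^+ n.+1 - dpow x h n.+1 =
    ((x + h) ^+ n - x ^+ n - dpow x h n) * x + ((x + h) ^+ n - x ^+ n) * h.
  rewrite /= !exprSr mulrDr !mulrBl opprD !addrA; congr (_ - _).
  by rewrite [RHS]addrAC; congr (_ - _); rewrite addrAC.
apply: norm_recurrence_le IHn _; first exact: lexx.
exact: exp_bounded_exprB.
Qed.

Definition dexp x h : A := expsum (dpow x h).

Lemma dexp_linear x (d : D) h k : dexp x (d *: h + k) = d *: dexp x h + dexp x k.
Proof.
have bh := exp_bounded_dpow x h.
rewrite /dexp -(expsumZ d bh) -(expsumD (exp_boundedZ d bh) (exp_bounded_dpow x k)).
by congr expsum; apply/funext => n; rewrite dpow_linear.
Qed.

Lemma dexp1 x : dexp x 1 = exponent x.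
Proof.
have cx : cvgn (series (fun n => ((n`!%:R^-1 : R)%:A : D) *: x ^+ n)).
  by apply: is_cvg_expsum (@exp_bounded_expr x x _); rewrite lerDl.
rewrite /dexp /expsum /exponent; apply: cvg_lim; first exact: norm_hausdorff.
(* The term of index 0 vanishes, and [n.+1 / n.+1]! = 1 / n[!] matches the shifted series with that
   of [exponent x]. *)
rewrite -cvg_shiftS; apply: cvg_trans cx; apply: near_eq_cvg.
near=> n; rewrite /series /= big_nat_recl//= scaler0 add0r.
apply: eq_big_nat => i _; rewrite -[_ + _]/(dpow x 1 i.+1) dpow1 scalerA.
congr (_ *: _).
rewrite -scalerAl mul1r -[i.+1%:R in RHS]scaler_nat scalerA factS natrM invfM.
by rewrite mulrAC mulVf ?mul1r// pnatr_eq0.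
Unshelve. all: by end_near. Qed.

Lemma exponent0 : exponent 0 = 1 :> A.
Proof.
apply: cvg_lim; first exact: norm_hausdorff.
(* Every nonempty partial sum is 1, because [0 ^+ 0 = 1] and the other powers vanish. *)
rewrite -cvg_shiftS; apply: cvg_near_cst; near=> n.
rewrite /series /= big_nat_recl// fact0 expr0 invr1 !scale1r big1 ?addr0//.
by move=> i _; rewrite expr0n scaler0.
Unshelve. all: by end_near. Qed.

Lemma exponent_rem_le x h : `|h| <= 1 ->
  `|exponent (x + h) - exponent x - dexp x h| <=
  `|1 : D| * `|1 : A| * expR (`|x| + 1) * `|h| * `|h|.
Proof.
move=> h1; have bx : exp_bounded (fun n => x ^+ n) `|1 : A| (`|x| + 1).
  by apply: exp_bounded_expr; rewrite lerDl.
have bd := exp_bounded_dpow x h; have br := exp_bounded_expr_rem x h1.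
have -> : exponent (x + h) = expsum (fun n => (x + h) ^+ n - x ^+ n - dpow x h n)
    + (dexp x h + exponent x).
  rewrite /dexp -(expsumD bd bx) -(expsumD br (exp_boundedD bd bx)).
  by congr expsum; apply/funext => n; rewrite addrA !subrK.
rewrite addrA addrK addrK (le_trans (norm_expsum_le br))//.
by rewrite [leLHS](_ : _ = `|1 : D| * `|1 : A| * expR (`|x| + 1) * `|h| * `|h|)//; ring.
Qed.

End ExponentialSum.

Theorem theorem8p1p3 (R : realType) (D : completeNormedComRingType R)
    (A : banachAlgType D) (C a b : A) (hab : a * b = C) :
  let y := fun x : A => a * exponent x * b in
  (forall x : A,
     exists2 dy : {linear A -> A}, is_derivative y x dy & dy 1 = y x) /\
  y 0 = C.
Proof.
move=> y; split=> [x|]; last by rewrite /y exponent0 mulr1.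
(* Left multiplication by [a] and right multiplication by [b] are [D]-linear, so they pass through
   the derivative. *)
pose f h := a * dexp x h * b.
have f_linear : linear f.
  move=> d h k.
  by rewrite /f dexp_linear mulrDr mulrDl -scalerAr -scalerAl.
pose fL := GRing.isLinear.Build D A A _ f f_linear.
pose dy : {linear A -> A} := HB.pack f fL.
exists dy; last by rewrite /= /f dexp1.
(* The remainder of [y] is at most [K * |h| * |h|] once [|h| <= 1]; using [K + 1] allows division
   even when [K = 0]. *)
move=> e e0; pose K := `|a| * (`|1 : D| * `|1 : A| * expR (`|x| + 1)) * `|b|.
have K0 : 0 <= K by rewrite !mulr_ge0// expR_ge0.
have K1 : 0 < K + 1 by rewrite ltr_wpDl.
near=> h.
have h1 : `|h| <= 1 by near: h; apply: filterS (nbhs0_lt ltr01) => h /ltW.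
have he : (K + 1) * `|h| <= e.
  rewrite mulrC -ler_pdivlMr//; near: h.
  by apply: filterS (nbhs0_lt (divr_gt0 e0 K1)) => h /ltW.
rewrite /= /y /f -!mulrBl -!mulrBr.
rewrite (le_trans (balg_normM _ _))//.
rewrite (le_trans (ler_wpM2r _ (balg_normM _ _)))//.
rewrite (le_trans (ler_wpM2r _ (ler_wpM2l _ (exponent_rem_le x h1))))//.
apply: le_trans (ler_wpM2r (normr_ge0 h) he).
rewrite [leLHS](_ : _ = K * `|h| * `|h|); last by rewrite /K; ring.
by rewrite !ler_wpM2r// lerDl.
Unshelve. all: by end_near. Qed.
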